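(* Let $Q$ be a finite (left) quasifield with $q$ elements and let $A,B,C,D\subset Q$. If $\gamma\in Q$ and $N_\gamma(A,B,C,D)$ is the number of solutions to $a + b + \gamma = c\cdot d$ with $a\in A$, $b\in B$, $c\in C$, $d\in D$, then \[ \left| N_\gamma(A,B,C,D) - \frac{(q+1)|A||B||C||D|}{q^2+q+1}\right| \leq q^{1/2}\sqrt{|A||B||C||D|}. \]
   Context: A (left) quasifield is a set $Q$ with two binary operations $+$ and $\cdot$ such that $(Q,+)$ is a group with identity $0$; $(Q\setminus\{0\},\cdot)$ is a loop (for all $a,b$ the equations $a\cdot x=b$ and $y\cdot a=b$ have unique solutions, and there is an identity $1$); $a\cdot(b+c)=a\cdot b+a\cdot c$ for all $a,b,c$; $0\cdot x=0$ for all $x$; and for $a\neq b$ the equation $a\cdot x=b\cdot x+c$ has exactly one solution $x$. *)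

(* Defs.v *)
From mathcomp Require Import all_boot.

Set Implicit Arguments.
Unset Strict Implicit.
Unset Printing Implicit Defensive.

Record is_group (T : Type) (op : T -> T -> T) (e : T) : Prop := IsGroup {
  group_assoc : associative op;
  group_left_id : left_id e op;
  group_right_id : right_id e op;
  group_inverse : forall x, exists y, op y x = e /\ op x y = e
}.

Record is_loop_on (T : Type) (P : T -> Prop) (op : T -> T -> T) : Prop :=
  IsLoopOn {
  loop_closed : forall a b, P a -> P b -> P (op a b);
  loop_left_div : forall a b, P a -> P b -> exists! x, P x /\ op a x = b;
  loop_right_div : forall a b, P a -> P b -> exists! y, P y /\ op y a = b;
  loop_identity :
    exists e, P e /\ forall x, P x -> op e x = x /\ op x e = x
}.

(* [add] is only required to be a group law, not a commutative one. *)
Record is_left_quasifield (Q : Type) (add mul : Q -> Q -> Q) (zero : Q) : Prop :=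
  IsLeftQuasifield {
  quasifield_group : is_group add zero;
  quasifield_loop : is_loop_on (fun x => x <> zero) mul;
  quasifield_distr : forall a b c, mul a (add b c) = add (mul a b) (mul a c);
  quasifield_mul0 : forall x, mul zero x = zero;
  quasifield_planar :
    forall a b c, a <> b -> exists! x, mul a x = add (mul b x) c
}.

Definition num_solutions (Q : finType) (add mul : Q -> Q -> Q) (gamma : Q)
    (A B C D : {set Q}) : nat :=
  #|[set u : Q * Q * Q * Q | let: (a, b, c, d) := u in
      [&& a \in A, b \in B, c \in C, d \in D &
          add (add a b) gamma == mul c d]]|.

(* Main.v *)
Require Import Defs.
From mathcomp Require Import all_boot all_order all_algebra.
From mathcomp Require Import ring lra.
Import Order.TTheory GRing.Theory Num.Theory.
Local Open Scope ring_scope.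

(** Read [a + b + gamma = c * d] as incidence of the point [(a, d)] with the
    line [(b, c)].  Each line has [q] points; two lines with distinct slopes [c]
    meet exactly once, and distinct lines of the same slope never meet.  This
    gives the first two moments, over all [q ^ 2] points, of the number [r] of
    lines of [B * C] through a point.  With [t = (q + 1) / (q ^ 2 + q + 1)] we
    have [1 - t q = 1 / (q ^ 2 + q + 1)], so the second moment of [r - t |B||C|]
    is at most [q |B||C|]; Cauchy-Schwarz over [A * D] concludes. *)

(** Cauchy-Schwarz against the constant 1. With [n] the size of [X], the sum of the squares
    [(n * f i - S) ^+ 2] equals [n * (n * S2 - S ^+ 2)]; cancelling [n] needs [X] nonempty. *)
Lemma sqr_sum_le (R : realFieldType) (I : finType) (X : {set I}) (f : I -> R) :
  (\sum_(i in X) f i) ^+ 2 <= #|X|%:R * \sum_(i in X) f i ^+ 2.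
Proof.
set S := \sum_(i in X) f i; set S2 := \sum_(i in X) f i ^+ 2.
have [X0|Xn0] := eqVneq #|X| 0%N.
  have X_0 : X = set0 by apply/eqP; rewrite -cards_eq0 X0.
  by rewrite /S X_0 big_set0 cards0 mul0r expr0n.
set n : R := #|X|%:R.
have n_gt0 : 0 < n by rewrite ltr0n lt0n.
have : 0 <= \sum_(i in X) (n * f i - S) ^+ 2.
  by apply: sumr_ge0 => i _; exact: sqr_ge0.
have -> : \sum_(i in X) (n * f i - S) ^+ 2 = n * (n * S2 - S ^+ 2).
  transitivity (\sum_(i in X) (n ^+ 2 * f i ^+ 2 - (n * S *+ 2) * f i + S ^+ 2)).
    by apply: eq_bigr => i _; ring.
  rewrite big_split sumrB /= -!mulr_sumr sumr_const -/S -/S2 -mulr_natr -/n.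
  by ring.
by rewrite pmulr_rge0 // subr_ge0.
Qed.

Lemma sum_setX (R : nmodType) (I J : finType) (X : {set I}) (Y : {set J})
    (F : I * J -> R) :
  \sum_(p in setX X Y) F p = \sum_(i in X) \sum_(j in Y) F (i, j).
Proof.
rewrite pair_big; apply: eq_big => [[i j]|[i j] _] //=.
by rewrite inE.
Qed.

Section Incidences.

Variables (R : realFieldType) (Q : finType) (add mul : Q -> Q -> Q) (zero : Q).
Hypothesis hQ : is_left_quasifield add mul zero.
Variable gamma : Q.

Let hG := quasifield_group hQ.

Lemma add_left_inj x y z : add x y = add x z -> y = z.
Proof.
have [x' [xK _]] := group_inverse hG x.
by move=> /(congr1 (add x')); rewrite !(group_assoc hG) xK !(group_left_id hG).
Qed.

(** Here [z] is the inverse of [y]. It lands on the right because [add] need not commute, and the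
    boolean equality allows rewriting. *)
Lemma eq_add_solve y :
  exists z, forall x w, (add x y == w) = (x == add w z).
Proof.
have [z [zK Kz]] := group_inverse hG y; exists z => x w.
apply/eqP/eqP => [<-|->]; rewrite -(group_assoc hG).
  by rewrite Kz (group_right_id hG).
by rewrite zK (group_right_id hG).
Qed.

Definition inc (p l : Q * Q) : bool :=
  add (add p.1 l.1) gamma == mul l.2 p.2.

(** A line is the graph of an affine function of [d], with [h] the inverse of [l.1 + gamma]: one
    point over each [d]. *)
Lemma inc_graph (l : Q * Q) :
  exists h, forall a d, inc (a, d) l = (a == add (mul l.2 d) h).
Proof.
have [z hz] := eq_add_solve (add l.1 gamma); exists z => a d.
by rewrite /inc /= -(group_assoc hG) hz.
Qed.

Lemma card_line l : \sum_p (inc p l)%:R = #|Q|%:R :> R.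
Proof.
have [h hh] := inc_graph l.
rewrite -(pair_bigA _ (fun a d => (inc (a, d) l)%:R)) exchange_big /=.
rewrite (eq_bigr (fun=> 1)) ?sumr_const // => d _.
rewrite (bigD1 (add (mul l.2 d) h)) //= hh eqxx big1 ?addr0 // => a /negPf ne_a.
by rewrite hh ne_a.
Qed.

Lemma meet_slope_neq b c b' c' : c != c' ->
  \sum_p (inc p (b, c) && inc p (b', c'))%:R = 1 :> R.
Proof.
move=> /eqP cc'.
have [h hh] := inc_graph (b, c); have [h' hh'] := inc_graph (b', c').
have [k hk] := eq_add_solve h.
(* With [k] the inverse of [h], the graphs agree over [d] iff [c d = c' d + (h' + k)], which
   planarity solves uniquely; [a] is then determined. *)
have [d [dP dU]] := quasifield_planar hQ (add h' k) cc'.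
rewrite (bigD1 (add (mul c d) h, d)) //= hh hh' /= eqxx /=.
have -> : add (mul c d) h == add (mul c' d) h'.
  by rewrite hk -(group_assoc hG) dP.
rewrite big1 ?addr0 // => -[a d'] ne; apply/eqP; rewrite pnatr_eq0 eqb0.
apply: contraNN ne; rewrite hh hh' => /andP[/eqP -> ].
rewrite hk -(group_assoc hG) => /eqP/dU ->.
exact: eqxx.
Qed.

(** A common point [(a, d)] gives [a + b + gamma = c d = a + b' + gamma], and cancellation forces
    [b = b']. *)
Lemma meet_slope_eq b b' c :
  \sum_p (inc p (b, c) && inc p (b', c))%:R = (b' == b)%:R * #|Q|%:R :> R.
Proof.
have [->|bb'] := eqVneq b' b.
  by rewrite mul1r -(card_line (b, c)); apply: eq_bigr => p _; rewrite andbb.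
rewrite mul0r big1 // => p _; apply/eqP; rewrite pnatr_eq0 eqb0.
apply/andP => -[/eqP /= e1 /eqP /= e2]; case/eqP: bb'.
have [z hz] := eq_add_solve gamma.
move: e1 e2 => /eqP + /eqP; rewrite !hz => /eqP <- /eqP.
exact: add_left_inj.
Qed.

Variables B C : {set Q}.

Definition lines_through (p : Q * Q) : R := \sum_(l in setX B C) (inc p l)%:R.

Lemma sum_lines_through : \sum_p lines_through p = #|Q|%:R * (#|B|%:R * #|C|%:R).
Proof.
rewrite exchange_big /= (eq_bigr (fun=> #|Q|%:R)) => [|l _]; last exact: card_line.
by rewrite sumr_const cardsX -[LHS]mulr_natr natrM.
Qed.

(** The square counts ordered pairs of lines through a point. A fixed [(b, c)] meets itself in [q]
    points, and each of the [(#|C| - 1) * #|B|] lines of another slope in one. *)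
Lemma sum_lines_through_sqr :
  \sum_p lines_through p ^+ 2 =
  #|B|%:R * #|C|%:R * (#|Q|%:R + (#|C|%:R - 1) * #|B|%:R).
Proof.
transitivity (\sum_(l in setX B C) \sum_(l' in setX B C)
                \sum_p (inc p l && inc p l')%:R : R).
  under [RHS]eq_bigr do rewrite exchange_big; rewrite exchange_big /=.
  apply: eq_bigr => p _; rewrite expr2 mulr_suml; apply: eq_bigr => l _.
  by rewrite mulr_sumr; apply: eq_bigr => l' _; rewrite -natrM mulnb.
rewrite (eq_bigr (fun=> #|Q|%:R + (#|C|%:R - 1) * #|B|%:R)) => [|[b c]].
  by rewrite sumr_const cardsX -[LHS]mulr_natr natrM mulrC.
rewrite inE /= => /andP[Bb Cc].
rewrite sum_setX exchange_big /= (bigD1 c) //=; congr (_ + _).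
  rewrite (eq_bigr (fun b' => (b' == b)%:R * #|Q|%:R)) => [|b' _]; last first.
    exact: meet_slope_eq.
  rewrite (bigD1 b) //= eqxx mul1r big1 ?addr0 // => b' /andP[_ /negPf ->].
  by rewrite mul0r.
rewrite (eq_bigr (fun=> #|B|%:R)) => [|c' /andP[_ cc']]; last first.
  rewrite (eq_bigr (fun=> 1)) ?sumr_const // => b' _.
  by apply: meet_slope_neq; rewrite eq_sym.
have -> : \sum_(i in C | i != c) #|B|%:R = \sum_(i in C :\ c) #|B|%:R :> R.
  by apply: eq_bigl => i; rewrite !inE andbC.
by rewrite sumr_const (cardsD1 c C) Cc -[LHS]mulr_natl natrD /=; ring.
Qed.

Lemma second_moment_lines_through (t : R) :
  t = (#|Q|%:R + 1) / (#|Q|%:R ^+ 2 + #|Q|%:R + 1) ->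
  \sum_p (lines_through p - t * (#|B|%:R * #|C|%:R)) ^+ 2 <=
  #|Q|%:R * (#|B|%:R * #|C|%:R).
Proof.
set q : R := #|Q|%:R; set n := q ^+ 2 + q + 1 => t_def.
set b : R := #|B|%:R; set c : R := #|C|%:R.
have q_ge1 : 1 <= q by rewrite ler1n; apply/card_gt0P; exists zero.
have c_le_q : c <= q by rewrite ler_nat max_card.
have b_ge0 : 0 <= b by rewrite ler0n.
have c_ge0 : 0 <= c by rewrite ler0n.
have n_ge1 : 1 <= n by rewrite /n; nra.
have n_gt0 : 0 < n := lt_le_trans ltr01 n_ge1.
have -> : \sum_p (lines_through p - t * (b * c)) ^+ 2 =
    b * c * (q + (c - 1) * b) - t * (b * c) *+ 2 * (q * (b * c))
    + (t * (b * c)) ^+ 2 * q ^+ 2.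
  rewrite -sum_lines_through_sqr -sum_lines_through mulr_sumr -sumrB.
  have -> : (t * (b * c)) ^+ 2 * q ^+ 2 = \sum_(p : Q * Q) (t * (b * c)) ^+ 2.
    by rewrite sumr_const card_prod -[RHS]mulr_natr natrM expr2.
  by rewrite -big_split; apply: eq_bigr => p _ /=; ring.
have tq : 1 - t * q = n^-1.
  by rewrite t_def /n; field; exact: lt0r_neq0.
have c_n : c * n^-1 ^+ 2 <= 1.
  rewrite exprVn ler_pdivrMr ?exprn_gt0 // mul1r; apply: (le_trans c_le_q).
  have q_le_n : q <= n by rewrite /n; nra.
  by apply: (le_trans q_le_n); rewrite expr2 ler_peMr // ltW.
(* The true mean is [b * c / q]. Centring at [t * (b * c)] instead costs
   [(b * c * (1 - t * q)) ^+ 2], which by [c_n] the term [- b ^+ 2 * c] absorbs. *)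
have -> : b * c * (q + (c - 1) * b) - t * (b * c) *+ 2 * (q * (b * c))
    + (t * (b * c)) ^+ 2 * q ^+ 2 =
    q * (b * c) - b ^+ 2 * c * (1 - c * (1 - t * q) ^+ 2).
  by ring.
by rewrite tq lerBlDr lerDl mulr_ge0 ?mulr_ge0 ?exprn_ge0 // subr_ge0.
Qed.

Lemma num_solutions_lines_through (A D : {set Q}) :
  (num_solutions add mul gamma A B C D)%:R =
  \sum_(p in setX A D) lines_through p :> R.
Proof.
(* [f] regroups a solution into its point [(a, d)] and line [(b, c)]; [g] undoes this. *)
pose f (u : Q * Q * Q * Q) := ((u.1.1.1, u.2), (u.1.1.2, u.1.2)).
pose g (v : (Q * Q) * (Q * Q)) := (v.1.1, v.2.1, v.2.2, v.1.2).
rewrite pair_big_dep /= -natr_sum /= -big_mkcondr sum1_card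
  /num_solutions; congr _%:R.
have fI : injective f by apply: (can_inj (g := g)) => -[[[]]].
rewrite -(card_imset _ fI); apply: eq_card => -[[a d] [b c]].
rewrite [RHS]unfold_in /= !in_setX /inc /=; apply/imsetP/idP => [[[[[a' b'] c'] d']]|].
  by rewrite inE => /and5P[Aa Bb Cc Dd e] [-> -> -> ->]; rewrite Aa Bb Cc Dd.
move=> /andP[/andP[/andP[Aa Dd] /andP[Bb Cc]] e]; exists (a, b, c, d) => //.
by rewrite inE Aa Bb Cc Dd.
Qed.

End Incidences.

Theorem theorem1p9 (R : rcfType) (Q : finType) (add mul : Q -> Q -> Q) (zero : Q)
    (hQ : is_left_quasifield add mul zero) (A B C D : {set Q}) (gamma : Q) :
  let q : R := #|Q|%:R in
  let P : R := #|A|%:R * #|B|%:R * #|C|%:R * #|D|%:R in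
  `| (num_solutions add mul gamma A B C D)%:R
     - (q + 1) * P / (q ^+ 2 + q + 1) |
    <= Num.sqrt q * Num.sqrt P.
Proof.
cbv zeta; set q : R := #|Q|%:R; set P : R := _ * #|D|%:R.
have q_ge0 : 0 <= q by rewrite ler0n.
(* Both sides become square roots, so it suffices to compare squares. *)
rewrite -sqrtrM // -sqrtr_sqr ler_wsqrtr //.
set t := (q + 1) / (q ^+ 2 + q + 1).
have -> : (num_solutions add mul gamma A B C D)%:R - (q + 1) * P / (q ^+ 2 + q + 1) =
    \sum_(p in setX A D)
      (@lines_through R Q add mul gamma B C p - t * (#|B|%:R * #|C|%:R)).
  rewrite sumrB -num_solutions_lines_through sumr_const cardsX; congr (_ - _).
  by rewrite -[RHS]mulr_natr natrM /P /t; ring.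
apply: (le_trans (sqr_sum_le _ _ _ _)).
have -> : q * P = #|setX A D|%:R * (q * (#|B|%:R * #|C|%:R)).
  by rewrite cardsX natrM /P; ring.
apply: ler_wpM2l => //.
(* Extending the sum from [setX A D] to all points only adds squares. *)
apply: le_trans (second_moment_lines_through _ _ _ _ _ hQ gamma B C _ erefl).
rewrite [leRHS](bigID [in setX A D]) /= lerDl.
by apply: sumr_ge0 => p _; exact: sqr_ge0.
Qed.
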